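(* For all $n\geq 0$: $d_8(3n+2)\equiv 0\pmod 9$ and $d_8(9n+3)\equiv 0\pmod 9$.
   Context: For each integer $k\geq 1$, the numbers $d_k(n)$ are defined by $\sum_{n\geq 0} d_k(n)q^n = \frac{f_2^k}{f_1^{3k+1}}$, where $f_r = \prod_{i\geq 1}(1-q^{ri})$. *)

(* Defs.v *)
(* Formal power series over int represented as coefficient
   sequences nat -> int. *)
From mathcomp Require Import all_boot all_order all_algebra.
Set Implicit Arguments. Unset Strict Implicit. Unset Printing Implicit Defensive.
Import GRing.Theory Num.Theory.
Local Open Scope ring_scope.

(* Coefficient of q^i in f_r = prod_{m>=1} (1 - q^(r m)); computed from the
   finite product over 1 <= m <= i, which agrees with f_r up to degree i. *)
Definition fr (r : nat) : nat -> int :=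
  fun i => (\prod_(1 <= m < i.+1) (1 - 'X^(r * m) : {poly int}))`_i.

Definition smul (a b : nat -> int) : nat -> int :=
  fun n => \sum_(j < n.+1) a j * b (n - j)%N.

Definition sone : nat -> int := fun n => if n == 0%N then 1 else 0.

Definition spow (a : nat -> int) (k : nat) : nat -> int := iter k (smul a) sone.

(* First n+1 coefficients of the inverse of a power series a with a 0 = 1:
   b 0 = 1, b m = - sum_{j=1}^m a j * b (m - j). *)
Fixpoint sinv_seq (a : nat -> int) (n : nat) : seq int :=
  match n with
  | 0 => [:: 1]
  | m.+1 => let s := sinv_seq a m in
            rcons s (- \sum_(1 <= j < m.+2) a j * nth 0 s (m.+1 - j)%N)
  end.

Definition sinv (a : nat -> int) : nat -> int := fun n => nth 0 (sinv_seq a n) n.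

Definition d (k n : nat) : int :=
  smul (spow (fr 2) k) (sinv (spow (fr 1) (3 * k + 1))) n.

(* Main.v *)
(** Modulo 9 one has [f_r^9 = f_(3r)^3], and Gauss' identity
    reads [f_1^2 = f_2 * phi] with [phi] the alternating theta series
    [sum_j (-1)^j q^(j^2)]. Multiplying the generating function
    [D = f_2^8 / f_1^25] by [f_1^27], which is [f_9^3] modulo 9, gives
    [D * f_9^3 = f_6^3 * phi] modulo 9. By Jacobi's identity the exponents of
    [f_1^3] are triangular numbers, hence never 2 modulo 3, so the exponents of
    [f_6^3] are 0 or 6 modulo 9; those of [phi] are 0, 1, 4 or 7. Hence the right
    side has no exponent congruent to 2, 3, 5 or 8 modulo 9, and dividing by
    [f_9^3], a series in [q^9] with constant term 1, preserves this.

    Gauss' and Jacobi's identities are obtained from the finite q-binomial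
    theorem, and power series are replaced by polynomials modulo [X^n]. *)
Require Import Defs.
From mathcomp Require Import all_boot all_order all_algebra.
From mathcomp Require Import ring zify.
Set Implicit Arguments. Unset Strict Implicit. Unset Printing Implicit Defensive.
Import GRing.Theory.
Local Open Scope ring_scope.

(** * Congruences in a commutative ring, for truncation modulo ['X^n] and reduction modulo 3 and
    9 *)

Definition congr_mod (R : comNzRingType) (a p q : R) := exists u, p = q + a * u.

Section Congruence.
Variables (R : comNzRingType) (a : R).
Implicit Types p q r s : R.

Lemma congr_mod_refl p : congr_mod a p p.
Proof. by exists 0; rewrite mulr0 addr0. Qed.

Lemma congr_mod_sym p q : congr_mod a p q -> congr_mod a q p.
Proof. by case=> u ->; exists (- u); ring. Qed.

Lemma congr_mod_trans q p r :
  congr_mod a p q -> congr_mod a q r -> congr_mod a p r.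
Proof. by case=> u -> [v ->]; exists (u + v); ring. Qed.

Lemma congr_modD p q r s :
  congr_mod a p q -> congr_mod a r s -> congr_mod a (p + r) (q + s).
Proof. by case=> u -> [v ->]; exists (u + v); ring. Qed.

Lemma congr_modM p q r s :
  congr_mod a p q -> congr_mod a r s -> congr_mod a (p * r) (q * s).
Proof. by case=> u -> [v ->]; exists (q * v + s * u + a * u * v); ring. Qed.

Lemma congr_modX p q n : congr_mod a p q -> congr_mod a (p ^+ n) (q ^+ n).
Proof.
move=> pq; elim: n => [|n IHn]; first exact: congr_mod_refl.
by rewrite !exprS; apply: congr_modM.
Qed.

Lemma congr_mod_sum (I : finType) (F G : I -> R) :
  (forall i, congr_mod a (F i) (G i)) ->
  congr_mod a (\sum_i F i) (\sum_i G i).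
Proof.
move=> FG; apply: (big_ind2 (congr_mod a)) => //; first exact: congr_mod_refl.
by move=> *; apply: congr_modD.
Qed.

Lemma congr_mod_prod (I : finType) (F G : I -> R) :
  (forall i, congr_mod a (F i) (G i)) ->
  congr_mod a (\prod_i F i) (\prod_i G i).
Proof.
move=> FG; apply: (big_ind2 (congr_mod a)) => //; first exact: congr_mod_refl.
by move=> *; apply: congr_modM.
Qed.

Lemma congr_mod_prod1 (I : finType) (F : I -> R) :
  (forall i, congr_mod a (F i) 1) -> congr_mod a (\prod_i F i) 1.
Proof. by move=> /congr_mod_prod; rewrite big1_eq. Qed.

Lemma congr_mod_weaken m n p q : (n <= m)%N ->
  congr_mod (a ^+ m) p q -> congr_mod (a ^+ n) p q.
Proof.
by move=> le_nm [u ->]; exists (a ^+ (m - n) * u); rewrite mulrA -exprD subnKC.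
Qed.

Lemma congr_mod_mulX m n p q :
  congr_mod (a ^+ m) p q -> congr_mod (a ^+ (n + m)) (a ^+ n * p) (a ^+ n * q).
Proof. by case=> u ->; exists u; rewrite exprD; ring. Qed.

End Congruence.

(** * The q-binomial theorem *)

Section QBinomial.
Variable R : comNzRingType.
Implicit Types q y z : R.

(** The q-Pochhammer symbol (q; q)_n; at [q = 'X^r] it truncates the product f_r. *)
Definition qpoch q n := \prod_(i < n) (1 - q ^+ i.+1).

Fixpoint gbin q m k : R :=
  match m, k with
  | _, 0 => 1
  | 0, _.+1 => 0
  | m'.+1, k'.+1 => gbin q m' k' + q ^+ k * gbin q m' k
  end.

Lemma gbin0 q m : gbin q m 0 = 1. Proof. by case: m. Qed.

Lemma gbin_small q m k : (m < k)%N -> gbin q m k = 0.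
Proof.
elim: m k => [|m IHm] [|k] //= lt_mk.
by rewrite !IHm ?mulr0 ?addr0 // ltnW.
Qed.

(** Induction on [m] for all [z]: splitting off the factor [i = 0] turns [z] into [z * q]. The form
    homogeneous in [y] and [z] avoids negative exponents when it is specialised. *)
Lemma gbin_theorem q y z m :
  \prod_(i < m) (y + z * q ^+ i) =
  \sum_(k < m.+1) q ^+ 'C(k, 2) * gbin q m k * z ^+ k * y ^+ (m - k).
Proof.
elim: m z => [|m IHm] z.
  by rewrite big_ord0 big_ord_recl big_ord0 /= !mulr1 addr0.
rewrite big_ord_recl expr0 mulr1.
under eq_bigr => i _ do rewrite lift0 exprS mulrA.
rewrite IHm mulrDl [in RHS]big_ord_recl.
under [in RHS]eq_bigr => i _ do
  rewrite lift0 /= subSS mulrDr !mulrDl.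
rewrite /= bin0n expr0 mulr1 !mul1r subn0 big_split /= addrA [in RHS]addrAC; congr (_ + _).
- rewrite big_ord_recl [in RHS]big_ord_recr /= (gbin_small q (ltnSn m)) !(mulr0, mul0r) addr0.
  rewrite bin0n expr0 gbin0 !mul1r subn0 mulrDr -exprS; congr (_ + _).
  rewrite mulr_sumr; apply: eq_bigr => i _; rewrite /bump /= add1n.
  have -> : (m - i = (m - i.+1).+1)%N by have := ltn_ord i; lia.
  by rewrite exprMn [y ^+ _.+1]exprS; ring.
- rewrite mulr_sumr; apply: eq_bigr => i _.
  by rewrite binS bin1 exprD exprMn [z ^+ _.+1]exprS; ring.
Qed.

Lemma qpoch0 q : qpoch q 0 = 1. Proof. exact: big_ord0. Qed.

Lemma qpochS q n : qpoch q n.+1 = qpoch q n * (1 - q ^+ n.+1).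
Proof. exact: big_ord_recr. Qed.

(** The Pascal rule matches the product because 1 - q^(m+1) = (1 - q^(k+1)) + q^(k+1) (1 -
    q^(m-k)). *)
Lemma gbin_qpoch q m k : (k <= m)%N ->
  gbin q m k * qpoch q k = \prod_(i < k) (1 - q ^+ (m - i)).
Proof.
elim: m k => [|m IHm] [|k] //=; rewrite ?qpoch0 ?big_ord0 ?mulr1 //.
rewrite ltnS => le_km; rewrite [in RHS]big_ord_recl subn0.
under [in RHS]eq_bigr => i _ do rewrite lift0 subSS.
rewrite -IHm //; move: le_km; rewrite leq_eqVlt => /orP[/eqP <-|lt_km].
  by rewrite (gbin_small q (ltnSn k)) mulr0 addr0 qpochS; ring.
rewrite mulrDl -mulrA (IHm k.+1 lt_km) big_ord_recr /= -(IHm k (ltnW lt_km)).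
rewrite qpochS.
have -> : q ^+ m.+1 = q ^+ k.+1 * q ^+ (m - k) by rewrite -exprD; congr (_ ^+ _); lia.
ring.
Qed.

Lemma qpoch_congr q m n : (m <= n)%N -> congr_mod (q ^+ m.+1) (qpoch q n) (qpoch q m).
Proof.
move=> le_mn; rewrite /qpoch -(subnKC le_mn) big_split_ord /= -[X in congr_mod _ _ X]mulr1.
apply: congr_modM; first exact: congr_mod_refl.
apply: congr_mod_prod1 => i; exists (- q ^+ i).
by rewrite mulrN -exprD; congr (1 - _ ^+ _); lia.
Qed.

(** Away from both ends a Gaussian binomial approximates 1 / (q; q)_oo: [qpoch q n] and [qpoch q k]
    agree to this order, and the exponents [m - i] with [i < k] exceed [m - k], hence [l]. *)
Lemma gbin_congr q m n k l : (k <= m)%N -> (l <= k)%N -> (l <= n)%N -> (l <= m - k)%N ->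
  congr_mod (q ^+ l.+1) (gbin q m k * qpoch q n) 1.
Proof.
move=> le_km le_lk le_ln le_lmk.
have qnk : congr_mod (q ^+ l.+1) (qpoch q n) (qpoch q k).
  apply: (congr_mod_trans (qpoch_congr q le_ln)).
  by apply: congr_mod_sym; apply: qpoch_congr.
apply: (congr_mod_trans (congr_modM (congr_mod_refl _ _) qnk)).
rewrite gbin_qpoch //; apply: congr_mod_prod1 => i; exists (- q ^+ (m - i - l.+1)).
by rewrite mulrN -exprD; congr (1 - _ ^+ _); have := ltn_ord i; lia.
Qed.

End QBinomial.

Lemma rmorph_gbin (R S : comNzRingType) (f : {rmorphism R -> S}) q m k :
  gbin (f q) m k = f (gbin q m k).
Proof.
elim: m k => [|m IHm] [|k] //=; rewrite ?rmorph1 ?rmorph0 //.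
by rewrite !IHm rmorphD rmorphM rmorphXn.
Qed.

(** * Gauss' identity *)

(* One of the truncated differences is 0, so this is [|k - n|^2]. *)
Definition dist2 (n k : nat) := (((k - n) + (n - k)) ^ 2)%N.

Lemma qpoch_odd_even (R : comNzRingType) (q : R) n :
  \prod_(i < n) (1 - q ^+ i.*2.+1) * qpoch (q ^+ 2) n = qpoch q n.*2.
Proof.
elim: n => [|n IHn]; first by rewrite big_ord0 !qpoch0 mulr1.
rewrite big_ord_recr doubleS !qpochS -IHn /= -exprM.
have -> : (2 * n.+1 = n.*2.+2)%N by lia.
ring.
Qed.

Lemma gauss_finite n :
  (\prod_(i < n) (1 - 'X ^+ i.*2.+1)) ^+ 2 =
  \sum_(k < n.*2.+1)
     (-1) ^+ (n + k) * 'X^(dist2 n k) * gbin 'X^2 n.*2 k :> {poly int}.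
Proof.
(* The q-binomial theorem at [q := X^2], [y := X^(2n)], [z := - X]. *)
set O := \prod_(i < n) _.
(* Pulling [- 'X^(i.*2.+1)] out of each factor leaves the factors of [O] in reverse order. *)
have lowE : \prod_(i < n) ('X^(n.*2) + - 'X * 'X^2 ^+ i) =
    (-1) ^+ n * 'X^(n ^ 2) * O :> {poly int}.
  rewrite (eq_bigr (fun i : 'I_n => -1 * 'X^(i.*2.+1) * (1 - 'X^((n - i.+1).*2.+1)))) => [|i _].
    rewrite !big_split /= prodr_const card_ord prodrXr; congr (_ * 'X^_ * _).
      by elim: n {O} => [|n IHn]; rewrite ?big_ord0 // big_ord_recr /= IHn; nia.
    by rewrite (reindex_inj rev_ord_inj); apply: eq_bigr => i _ /=;
       congr (1 - 'X^(_.*2.+1)); have := ltn_ord i; lia.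
  have -> : (n.*2 = i.*2.+1 + (n - i.+1).*2.+1)%N by have := ltn_ord i; lia.
  by rewrite exprD -!exprM mul2n exprS; ring.
have highE : \prod_(i < n) ('X^(n.*2) + - 'X * 'X^2 ^+ (n + i)) =
    'X^(n.*2 * n) * O :> {poly int}.
  rewrite (eq_bigr (fun i : 'I_n => 'X^(n.*2) * (1 - 'X^(i.*2.+1)))) => [|i _].
    by rewrite big_split /= prodr_const card_ord -exprM.
  by rewrite -exprM mul2n doubleD exprD exprS; ring.
have := gbin_theorem 'X^2 'X^(n.*2) (- 'X : {poly int}) n.*2.
have -> : \prod_(i < n.*2) ('X^(n.*2) + - 'X * 'X^2 ^+ i) =
    (-1) ^+ n * 'X^(n ^ 2) * O * ('X^(n.*2 * n) * O) :> {poly int}.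
  by rewrite -lowE -highE; move: 'X^(n.*2) => y; rewrite -addnn big_split_ord.
move=> gbinE.
have X3n : 'X^(3 * n ^ 2) != 0 :> {poly int} by rewrite monic_neq0 ?monicXn.
apply: (mulfI X3n); rewrite mulr_sumr.
transitivity ((-1) ^+ n * ((-1) ^+ n * 'X^(n ^ 2) * O * ('X^(n.*2 * n) * O))).
  have -> : (3 * n ^ 2 = n ^ 2 + n.*2 * n)%N by nia.
  rewrite exprD -[LHS]mul1r -{1}(sqrr_sign {poly int} n).
  by move: ((-1) ^+ n) 'X^(n ^ 2) 'X^(n.*2 * n) => s x y; ring.
rewrite gbinE mulr_sumr; apply: eq_bigr => k _.
(* The left side collects the exponents from q^C(k,2), z^k and y^(2n-k); completing the square
   leaves (k - n)^2 beyond the common 3n^2. *)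
have kE : (2 * 'C(k, 2) + k + n.*2 * (n.*2 - k) = 3 * n ^ 2 + dist2 n k)%N.
  have : (2 * 'C(k, 2) = k * k.-1)%N by rewrite -mul_bin_diag bin1.
  rewrite /dist2 => ->; have {lowE highE gbinE X3n O} := ltn_ord k.
  case: k => k /= _ lt_k.
  have -> : (k * k.-1 + k = k ^ 2)%N by case: k {lt_k} => // j; nia.
  have [le_nk|/ltnW le_kn] := leqP n k.
    have [j kE] : exists j, k = (n + j)%N by exists (k - n)%N; lia.
    have [m nE] : exists m, n = (j + m)%N by exists (n - j)%N; lia.
    have -> : (n.*2 - k = m)%N by lia.
    have -> : (k - n + (n - k) = j)%N by lia.
    by rewrite kE nE; nia.
  have [j nE] : exists j, n = (k + j)%N by exists (n - k)%N; lia.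
  have -> : (n.*2 - k = k + j.*2)%N by lia.
  have -> : (k - n + (n - k) = j)%N by lia.
  by rewrite nE; nia.
rewrite [(- 'X) ^+ _]exprNn -!exprM exprD.
transitivity ((-1) ^+ n * (-1) ^+ k *
  'X^(2 * 'C(k, 2) + k + n.*2 * (n.*2 - k)) * gbin 'X^2 n.*2 k : {poly int}).
  by rewrite !exprD; ring.
by rewrite kE exprD; ring.
Qed.

(** The finite identity is multiplied by the square of [qpoch 'X^2 n]; one of the two factors
    cancels the Gaussian binomials. *)
Lemma gauss_congr n :
  congr_mod 'X^n (qpoch 'X n.*2 ^+ 2)
    (qpoch 'X^2 n * \sum_(k < n.*2.+1) (-1) ^+ (n + k) * 'X^(dist2 n k) : {poly int}).
Proof.
rewrite -qpoch_odd_even exprMn gauss_finite [qpoch _ _ ^+ 2]expr2 mulrCA.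
apply: congr_modM; first exact: congr_mod_refl.
rewrite mulr_suml; apply: congr_mod_sum => k.
rewrite -[X in congr_mod _ _ X]mulr1 -!mulrA.
apply: congr_modM; first exact: congr_mod_refl.
have lt_k := ltn_ord k.
(* This is the distance from [k] to the nearer end of the range. With d = |k - n|, the precision d^2
   + 2(n - d + 1) is at least n. *)
pose l := (n - ((k - n) + (n - k)))%N.
apply: (@congr_mod_weaken _ _ (dist2 n k + 2 * l.+1)).
  by rewrite /dist2 /l; nia.
apply: congr_mod_mulX; rewrite exprM.
by apply: gbin_congr; rewrite /l; lia.
Qed.

(** * Jacobi's identity *)

(* With [j = k - n], possibly negative, this is [j * (j - 1) / 2]; at most one of
   the two summands is nonzero, because subtraction is truncated. *)
Definition tri (n k : nat) := ('C(k - n, 2) + 'C((n - k).+1, 2))%N.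

Lemma mul2_bin2 n : (2 * 'C(n, 2) = n * n.-1)%N.
Proof. by rewrite -mul_bin_diag bin1. Qed.

(** The left side is the exponent in the k-th term of the q-binomial theorem for [y = 'X^n]; on the
    right, [tri n k] is what remains beyond the monomial common to all terms. *)
Lemma tri_exponent n k : (k < n.*2.+2)%N ->
  ('C(k, 2) + n * (n.*2.+1 - k) = n + 'C(n, 2) + n * n + tri n k)%N.
Proof.
have := mul2_bin2 k; have := mul2_bin2 n.
have := mul2_bin2 (k - n); have := mul2_bin2 (n - k).+1; rewrite /tri.
move: 'C(k, 2) 'C(n, 2) 'C(k - n, 2) 'C((n - k).+1, 2) => a b c d.
have [le_nk|/ltnW le_kn] := leqP n k => + + + + lt_k.
  have [j kE] : exists j, k = (n + j)%N by exists (k - n)%N; lia.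
  have [m nE] : exists m, n.+1 = (j + m)%N by exists (n.+1 - j)%N; lia.
  have -> : (n.*2.+1 - k = m)%N by lia.
  have [-> ->] : (k - n = j)%N /\ (n - k = 0)%N by lia.
  rewrite {le_nk lt_k}kE; case: j nE => [|j] nE; case: n nE => [|n] nE /=; nia.
have [j nE] : exists j, n = (k + j)%N by exists (n - k)%N; lia.
have -> : (n.*2.+1 - k = k + j.*2.+1)%N by lia.
have [-> ->] : (k - n = 0)%N /\ (n - k = j)%N by lia.
by subst n; clear; case: k => [|k]; case: j => [|j] /=; nia.
Qed.

Lemma jacobi_finite n :
  qpoch 'X n ^+ 2 =
  \sum_(k < n.*2.+2)
     (-1) ^+ (n + k).+1 * k%:R * 'X^(tri n k) * gbin 'X n.*2.+1 k :> {poly int}.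
Proof.
(* The q-binomial theorem in an outer variable [z] has a factor vanishing at
   [z = 1]; its derivative there is, up to a monomial, [P ^+ 2]. *)
set P := qpoch _ _.
pose Q : {poly {poly int}} := 'X%:P.
pose F i : {poly {poly int}} := ('X^n)%:P + - 'X * Q ^+ i.
have FE i : (F i).[1] = 'X^n - 'X^i.
  by rewrite /F /Q -rmorphXn /= !hornerE mulN1r.
have dFE i : (F i)^`().[1] = - 'X^i.
  by rewrite /F /Q -rmorphXn /= !derivE !hornerE; ring.
have prodFE := gbin_theorem Q ('X^n)%:P (- 'X) n.*2.+1.
have {prodFE} : \prod_(i < n.*2.+1) F i = _ := prodFE.
clearbody F => prodFE.
have lowE : (\prod_(i < n) F i).[1] = (-1) ^+ n * 'X^'C(n, 2) * P.
  rewrite horner_prod (eq_bigr (fun i : 'I_n => -1 * 'X^i * (1 - 'X^((n - i.+1).+1)))) => [|i _].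
    rewrite !big_split /= prodr_const card_ord prodrXr -bin2_sum big_mkord.
    congr (_ * _).
    by rewrite (reindex_inj rev_ord_inj); apply: eq_bigr => i _ /=;
       congr (1 - 'X^(_.+1)); have := ltn_ord i; lia.
  rewrite FE; have {1}-> : (n = i + (n - i.+1).+1)%N by have := ltn_ord i; lia.
  by rewrite exprD; ring.
have highE : (\prod_(i < n) F (n + i.+1)%N).[1] = 'X^(n * n) * P.
  rewrite horner_prod (eq_bigr (fun i : 'I_n => 'X^n * (1 - 'X^(i.+1)))) => [|i _].
    by rewrite big_split /= prodr_const card_ord -exprM.
  by rewrite FE exprD; ring.
(* [F n] vanishes at 1, so only the term of the product rule that differentiates [F n] survives. *)
have derivE : (\prod_(i < n.*2.+1) F i)^`().[1] =
    - ((-1) ^+ n * 'X^(n + 'C(n, 2) + n * n) * P ^+ 2).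
  have -> : \prod_(i < n.*2.+1) F i =
      \prod_(i < n) F i * (F n * \prod_(i < n) F (n + i.+1)%N).
    rewrite -addnn -addnS big_split_ord big_ord_recl /= addn0.
    by under [X in _ = _ * (_ * X)]eq_bigr => i _ do rewrite -add1n.
  rewrite !derivM !hornerD !hornerM !hornerD !hornerM FE dFE subrr lowE highE.
  by rewrite !exprD; ring.
have := derivE; rewrite prodFE => gbinE.
have Xc : 'X^(n + 'C(n, 2) + n * n) != 0 :> {poly int} by rewrite monic_neq0 ?monicXn.
apply: (mulfI Xc); rewrite mulr_sumr.
transitivity (- (-1) ^+ n * - ((-1) ^+ n * 'X^(n + 'C(n, 2) + n * n) * P ^+ 2)).
  rewrite -[LHS]mul1r -{1}(sqrr_sign {poly int} n).
  by move: ((-1) ^+ n) 'X^(n + 'C(n, 2) + n * n) => s x; ring.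
rewrite -gbinE [deriv _]raddf_sum horner_sum mulr_sumr; apply: eq_bigr => k _.
have kE := tri_exponent (ltn_ord k).
rewrite rmorph_gbin; move: (gbin 'X _ _) => B; rewrite /Q -!rmorphXn /= [(- 'X) ^+ _]exprNn.
have -> : (-1) ^+ k = ((-1) ^+ k)%:P :> {poly {poly int}} by rewrite rmorph_sign.
rewrite -exprM.
(* Each term is a constant times the k-th power of the outer variable, so differentiating at 1
   yields the coefficient k. *)
transitivity (- (-1 : {poly int}) ^+ n *
  (('X^('C(k, 2) + n * (n.*2.+1 - k)) * B * (-1) ^+ k)%:P * 'X^k : {poly {poly int}})^`().[1]).
  congr (_ * _^`().[1]); rewrite exprD !polyCM; ring.
rewrite deriv_mulC derivXn hornerCM hornerMn hornerXn expr1n kE exprD exprS [(-1) ^+ (_ + _)]exprD.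
ring.
Qed.

(** The third factor [qpoch 'X n] cancels the Gaussian binomials. Pairing k = n + 1 + j with k = n -
    j would give the usual coefficients (-1)^j (2j + 1). *)
Lemma jacobi_congr n :
  congr_mod 'X^n (qpoch 'X n ^+ 3)
    (\sum_(k < n.*2.+2) (-1) ^+ (n + k).+1 * k%:R * 'X^(tri n k) : {poly int}).
Proof.
rewrite exprSr jacobi_finite mulr_suml; apply: congr_mod_sum => k.
rewrite -[X in congr_mod _ _ X]mulr1 -!mulrA.
do 2 (apply: congr_modM; first exact: congr_mod_refl).
have lt_k := ltn_ord k.
(* A term near an end of the range has a small [l] but a large triangular exponent, so the total
   precision still reaches n. *)
pose l := minn n (minn k (n.*2.+1 - k)).
apply: (@congr_mod_weaken _ _ (tri n k + l.+1)).
  have := mul2_bin2 (k - n); have := mul2_bin2 (n - k).+1.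
  rewrite /tri /l; move: 'C(k - n, 2) 'C((n - k).+1, 2) => c d /=.
  have [lt_nk|le_kn] := ltnP n k.
    have [j kE] : exists j, k = (n + j.+1)%N :> nat by exists (k - n.+1)%N; lia.
    have -> : (k - n = j.+1)%N by lia.
    have -> : (n - k = 0)%N by lia.
    have : (j <= n)%N by lia.
    by rewrite kE; case: j {kE} => [|j] /=; nia.
  have -> : (k - n = 0)%N by lia.
  have [j nE] : exists j, n = (k + j)%N by exists (n - k)%N; lia.
  have -> : (n - k = j)%N by lia.
  by clear -nE; case: j nE => [|j] /=; nia.
apply: congr_mod_mulX.
by apply: gbin_congr; rewrite /l; lia.
Qed.

(** * Congruences modulo 3 and 9 *)

(** Factor by factor, (1 - x)^3 = 1 - x^3 + 3 (x^2 - x). *)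
Lemma qpoch_exp3 (R : comNzRingType) (q : R) n :
  congr_mod 3 (qpoch q n ^+ 3) (qpoch (q ^+ 3) n).
Proof.
rewrite /qpoch -prodrXl; apply: congr_mod_prod => i.
by exists ((q ^+ i.+1) ^+ 2 - q ^+ i.+1); rewrite exprAC; ring.
Qed.

(** Cubing lifts a congruence modulo 3 to one modulo 9: (b + 3u)^3 = b^3 + 9 (b^2 u + 3 b u^2 + 3
    u^3). *)
Lemma qpoch_exp9 (R : comNzRingType) (q : R) n :
  congr_mod 9 (qpoch q n ^+ 9) (qpoch (q ^+ 3) n ^+ 3).
Proof.
have -> : (9 = 3 * 3)%N by []; rewrite exprM; have [u ->] := qpoch_exp3 q n.
by exists (qpoch (q ^+ 3) n ^+ 2 * u + 3 * qpoch (q ^+ 3) n * u ^+ 2 + 3 * u ^+ 3); ring.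
Qed.

Lemma qpoch_comp_Xn (R : comNzRingType) r n :
  qpoch 'X^r n = qpoch 'X n \Po 'X^r :> {poly R}.
Proof.
rewrite /qpoch rmorph_prod; apply: eq_bigr => i _ /=.
by rewrite rmorphB rmorph1 rmorphXn /= comp_polyX.
Qed.

Lemma coef_congr_Xn (R : comNzRingType) (p q : {poly R}) L i :
  congr_mod 'X^L p q -> (i < L)%N -> p`_i = q`_i.
Proof. by case=> u -> lt_iL; rewrite coefD coefXnM lt_iL addr0. Qed.

Lemma congr_Xn_coef (R : comNzRingType) (p q : {poly R}) L :
  (forall i, (i < L)%N -> p`_i = q`_i) -> congr_mod 'X^L p q.
Proof.
move=> pq; exists (drop_poly L (p - q)); apply/polyP=> i.
rewrite coefD coefXnM coef_drop_poly; case: ltnP => [/pq ->|le_Li].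
  by rewrite addr0.
by rewrite subnK // coefB addrC subrK.
Qed.

(** * Residues of the exponents *)

Lemma tri_mod3 n k : (tri n k %% 3 != 2)%N.
Proof.
have := mul2_bin2 (k - n); have := mul2_bin2 (n - k).+1; rewrite /tri.
move: 'C(k - n, 2) 'C((n - k).+1, 2) => c d.
(* Twice a triangular number has the form j (j - 1); a triangular number congruent to 2 would make
   it 1 modulo 3. *)
have h j : (j * j.-1 %% 3 != 1)%N.
  case: j => // j /=; rewrite -modnMm -addn1 -modnDml.
  by have := ltn_pmod j (isT : 0 < 3)%N; case: (j %% 3)%N => [|[|[|]]].
have [lt_nk|le_kn] := ltnP n k.
  have -> : (n - k = 0)%N by lia.
  by have := h (k - n)%N; lia.
have -> : (k - n = 0)%N by lia.
by have := h (n - k).+1; lia.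
Qed.

Lemma coef_qpoch_cube n i : (i < n)%N -> (i %% 3 = 2)%N ->
  (qpoch 'X n ^+ 3 : {poly int})`_i = 0.
Proof.
move=> lt_in i2; rewrite (coef_congr_Xn (jacobi_congr n) lt_in) coef_sum.
apply: big1 => k _.
have -> : (-1) ^+ (n + k).+1 * k%:R = ((-1) ^+ (n + k).+1 * k%:R)%:P :> {poly int}.
  by rewrite rmorphM rmorph_sign rmorph_nat.
rewrite coefCM coefXn; case: eqP => [iE|_]; last by rewrite mulr0.
by have := tri_mod3 n k; rewrite -iE i2.
Qed.

Lemma coef_qpoch6_cube n j : (j < n)%N -> (j %% 9 != 0)%N -> (j %% 9 != 6)%N ->
  (qpoch 'X^6 n ^+ 3 : {poly int})`_j = 0.
Proof.
move=> lt_jn j0 j6; rewrite qpoch_comp_Xn -rmorphXn /= coef_comp_poly_Xn //.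
case: ifP => // /dvdnP[i jE]; rewrite jE mulnK //.
by apply: coef_qpoch_cube; lia.
Qed.

Lemma dist2_mod9 n k :
  (dist2 n k %% 9 \in [:: 0; 1; 4; 7])%N.
Proof.
rewrite /dist2 -modnXm.
by have := ltn_pmod (k - n + (n - k)) (isT : 0 < 9)%N; case: (_ %% 9)%N; do 9?case=> //.
Qed.

(** Adding 0 or 6 to one of 0, 1, 4, 7 gives only 0, 1, 4, 6 or 7 modulo 9. *)
Lemma coef_cube_theta n i : (i < n)%N -> (i %% 9 \in [:: 2; 3; 5; 8])%N ->
  (qpoch 'X^6 n ^+ 3 *
   \sum_(k < n.*2.+1) (-1) ^+ (n + k) * 'X^(dist2 n k) : {poly int})`_i = 0.
Proof.
move=> lt_in iS; rewrite mulr_sumr coef_sum; apply: big1 => k _.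
have -> : (-1) ^+ (n + k) = ((-1) ^+ (n + k))%:P :> {poly int}.
  by rewrite rmorph_sign.
rewrite mulrCA coefCM coefMXn; case: ltnP => [_|le_di]; first by rewrite mulr0.
rewrite coef_qpoch6_cube ?mulr0 //; first by lia.
  by apply/negP=> /eqP; move: iS (dist2_mod9 n k); rewrite !inE; lia.
by apply/negP=> /eqP; move: iS (dist2_mod9 n k); rewrite !inE; lia.
Qed.

(** Strong induction: the i-th coefficient of [D * B] is that of [D] plus multiples of earlier
    coefficients of [D] whose indices have the same residue modulo 9. *)
Lemma dvdz_coef_factor (D B : {poly int}) (S : pred nat) L :
  B`_0 = 1 -> (forall i, ~~ (9 %| i)%N -> B`_i = 0) ->
  (forall i, (i < L)%N -> S (i %% 9)%N -> (9 %| (D * B)`_i)%Z) ->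
  forall i, (i < L)%N -> S (i %% 9)%N -> (9 %| D`_i)%Z.
Proof.
move=> B0 Bsupp dvdDB i; have [m] := ubnP i.
elim: m i => // m IHm i le_im lt_iL Si.
have := dvdDB i lt_iL Si; rewrite coefM big_ord_recr /= subnn B0 mulr1.
rewrite rpredDl //; apply: rpred_sum => j _.
have lt_ji := ltn_ord j.
have [dv|ndv] := boolP (9 %| i - j)%N; last by rewrite Bsupp ?mulr0.
apply: dvdz_mulr; apply: IHm; [lia | lia |].
by have -> : (j %% 9 = i %% 9)%N by lia.
Qed.

Lemma coef_qpoch9_supp n i : ~~ (9 %| i)%N ->
  (qpoch 'X^9 n ^+ 3 : {poly int})`_i = 0.
Proof.
by move=> ndv; rewrite qpoch_comp_Xn -rmorphXn /= coef_comp_poly_Xn // (negbTE ndv).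
Qed.

Lemma coef0_qpoch (R : comNzRingType) r n : (0 < r)%N -> (qpoch 'X^r n : {poly R})`_0 = 1.
Proof.
move=> r_gt0; rewrite (@coef_congr_Xn _ _ 1 1 0) ?coef1 //.
apply: congr_mod_prod1 => i; exists (- 'X^((r * i.+1).-1)).
by rewrite -exprM mulrN -exprD add1n prednK // muln_gt0 r_gt0.
Qed.

(** * Truncations of the generating function *)

Lemma fr_coef r n i : (0 < r)%N -> (i <= n)%N -> fr r i = (qpoch 'X^r n)`_i.
Proof.
move=> r_gt0 le_in; rewrite /fr big_add1 big_mkord.
under eq_bigr => j _ do rewrite exprM.
apply/esym/(@coef_congr_Xn _ _ _ (r * i.+1)); last by nia.
by rewrite exprM; apply: qpoch_congr.
Qed.

Definition agree L (a : nat -> int) (p : {poly int}) :=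
  forall i, (i < L)%N -> a i = p`_i.

Lemma agree_mul L a b p r : agree L a p -> agree L b r -> agree L (smul a b) (p * r).
Proof.
move=> ap br i lt_iL; rewrite /smul coefM; apply: eq_bigr => j _.
by have := ltn_ord j => lt_ji; rewrite ap ?br //; lia.
Qed.

Lemma agree_pow L a p k : agree L a p -> agree L (spow a k) (p ^+ k).
Proof.
move=> ap; elim: k => [|k IHk]; last by rewrite exprS; apply: agree_mul.
by move=> i _; rewrite expr0 coef1 /spow /= /sone; case: eqP.
Qed.

Lemma agree_poly L a : agree L a (\poly_(i < L) a i).
Proof. by move=> i lt_iL; rewrite coef_poly lt_iL. Qed.

Lemma agree_congr L a p r : agree L a p -> agree L a r -> congr_mod 'X^L p r.
Proof. by move=> ap ar; apply: congr_Xn_coef => i lt_iL; rewrite -ap // ar. Qed.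

Lemma size_sinv_seq a n : size (sinv_seq a n) = n.+1.
Proof. by elim: n => //= n IHn; rewrite size_rcons IHn. Qed.

Lemma nth_sinv_seq a n i : (i <= n)%N -> nth 0 (sinv_seq a n) i = sinv a i.
Proof.
elim: n => [|n IHn]; first by case: i.
rewrite leq_eqVlt => /orP[/eqP -> //|le_in].
by rewrite /= nth_rcons size_sinv_seq le_in IHn.
Qed.

Lemma smul_sinv a n : a 0 = 1 -> smul a (sinv a) n = sone n.
Proof.
move=> a0; case: n => [|n]; first by rewrite /smul big_ord1 a0 mul1r.
rewrite /smul big_ord_recl a0 mul1r subn0 {1}/sinv /= nth_rcons size_sinv_seq ltnn eqxx.
rewrite big_add1 big_mkord addrC /sone /=.
apply/eqP; rewrite subr_eq0; apply/eqP; apply: eq_bigr => j _.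
by rewrite /bump /= add1n subSS nth_sinv_seq ?leq_subr.
Qed.

(** The generating function with its denominator cleared. Truncating f_1 at [n.*2] factors matches
    the form of [gauss_congr]. *)
Lemma d_congr k n : exists2 D, agree n (d k) D &
  congr_mod 'X^n (D * qpoch 'X n.*2 ^+ (3 * k + 1)) (qpoch 'X^2 n ^+ k).
Proof.
have fr1 : agree n (fr 1) (qpoch 'X n.*2).
  by move=> i lt_in; rewrite (@fr_coef 1 n.*2) ?expr1 //; lia.
have fr2 : agree n (fr 2) (qpoch 'X^2 n).
  by move=> i /ltnW lt_in; apply: fr_coef.
set e := (3 * k + 1)%N.
pose b := spow (fr 1) e.
have b0 : b 0 = 1.
  rewrite /b (@agree_pow 1 _ (qpoch 'X^1 0)) // => [|i]; first by rewrite qpoch0 expr1n coef1.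
  by rewrite ltnS leqn0 => /eqP ->; apply: fr_coef.
pose I := \poly_(i < n) sinv b i.
have agI : agree n (sinv b) I by apply: agree_poly.
exists (qpoch 'X^2 n ^+ k * I).
  by apply: agree_mul => //; apply: agree_pow.
rewrite -mulrA -[X in congr_mod _ _ X]mulr1.
apply: congr_modM; first exact: congr_mod_refl.
apply: (@agree_congr _ sone); last by move=> i _; rewrite coef1 /sone; case: eqP.
move=> i lt_in; rewrite -(smul_sinv i b0) mulrC; apply: agree_mul i lt_in => //.
exact: agree_pow.
Qed.

(** * Divisibility by 9 *)

Lemma dvdz_d8 i : (i %% 9 \in [:: 2; 3; 5; 8])%N -> (9 %| d 8 i)%Z.
Proof.
move=> iS; pose n := i.+1; have [D dD [u DE]] := d_congr 8 n.
rewrite (dD i (ltnSn i)).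
have [v gaussE] := gauss_congr n.
set T := \sum_(_ < _) _ in gaussE.
have [w P2E] := qpoch_exp9 ('X^2 : {poly int}) n.
have [x P1E] : congr_mod 9 (qpoch 'X n.*2 ^+ 27) (qpoch ('X^9) n.*2 ^+ 3 : {poly int}).
  have -> : (27 = 9 * 3)%N by []; rewrite exprM.
  apply: (congr_mod_trans (congr_modX 3 (qpoch_exp9 _ _))).
  have -> : 'X^9 = 'X^3 ^+ 3 :> {poly int} by rewrite -exprM.
  by rewrite -[(qpoch _ _ ^+ 3) ^+ 3]exprM; apply: qpoch_exp9.
apply: (@dvdz_coef_factor D (qpoch 'X^9 n.*2 ^+ 3) (mem [:: 2; 3; 5; 8]%N) n) => //.
- by rewrite -horner_coef0 horner_exp horner_coef0 coef0_qpoch // expr1n.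
- by move=> j; apply: coef_qpoch9_supp.
move=> j lt_jn jS.
(* The multiple of 9 collects the errors of the two reductions of ninth powers, the multiple of
   ['X^n] those of the two truncations. *)
have -> : D * qpoch 'X^9 n.*2 ^+ 3 = qpoch 'X^6 n ^+ 3 * T
    + 9 * (w * T - D * x)
    + 'X^n * (qpoch 'X^2 n ^+ 8 * v + u * (qpoch 'X n.*2 ^+ 2)).
  rewrite -exprM in P2E; move: DE gaussE P2E P1E.
  move: (qpoch 'X _) (qpoch 'X^2 n) (qpoch 'X^9 _) (qpoch 'X^6 _) => P P2 P9 P6.
  move=> DE gaussE P2E P1E.
  have -> : P9 ^+ 3 = P ^+ 25 * P ^+ 2 - 9 * x by rewrite -exprD P1E addrK.
  have -> : P6 ^+ 3 = P2 ^+ 8 * P2 - 9 * w by rewrite -exprSr P2E addrK.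
  by rewrite mulrBr mulrA DE gaussE; ring.
rewrite !coefD coef_cube_theta // add0r coefXnM lt_jn addr0.
by rewrite mulr_natl coefMn -[_`_j *+ 9]mulr_natr; apply: dvdz_mull.
Qed.

Close Scope ring_scope.

Theorem theorem3p6 : forall n : nat,
  (9 %| d 8 (3 * n + 2))%Z /\ (9 %| d 8 (9 * n + 3))%Z.
(* 3n + 2 is 2, 5 or 8 modulo 9, and 9n + 3 is 3. *)
Proof. by move=> n; split; apply: dvdz_d8; rewrite !inE; lia. Qed.
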